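(* Let $\Omega\subsetneq\mathbb{R}^{2n+1}$ be a nonempty open convex set (convex in the Euclidean sense; not necessarily bounded). For $\xi\in\Omega$ let $\hat\xi\in\partial\Omega$ be a point with $|\xi-\hat\xi|=\operatorname{dist}(\xi,\partial\Omega)$ and let $\nu(\xi)=(\hat\xi-\xi)/|\hat\xi-\xi|\in\mathbb{S}^{2n}$. Then for every $p\ge2$ and every $u\in C_0^\infty(\Omega)$, \[ \int_\Omega|\nabla_{\mathbb{H}^n}u|^p\,d\xi\ge\Bigl(\frac{p-1}{p}\Bigr)^p\int_\Omega\sum_{i=1}^n\frac{|\langle X_i(\xi),\nu(\xi)\rangle|^p+|\langle Y_i(\xi),\nu(\xi)\rangle|^p}{\operatorname{dist}(\xi,\partial\Omega)^p}|u|^p\,d\xi . \]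
   Context: $\mathbb{H}^n$ is $\mathbb{R}^{2n+1}$ with points $\xi=(x,y,t)$, $x,y\in\mathbb{R}^n$, $t\in\mathbb{R}$, and Lebesgue measure. For $1\le i\le n$, $X_i=\partial_{x_i}+2y_i\partial_t$, $Y_i=\partial_{y_i}-2x_i\partial_t$, identified with their coefficient vectors in $\mathbb{R}^{2n+1}$; $\langle\cdot,\cdot\rangle$ is the Euclidean inner product. $\nabla_{\mathbb{H}^n}u=(X_1u,\dots,X_nu,Y_1u,\dots,Y_nu)$ and $|\nabla_{\mathbb{H}^n}u|=\bigl(\sum_i(|X_iu|^2+|Y_iu|^2)\bigr)^{1/2}$. $\operatorname{dist}$ is Euclidean distance and $\mathbb{S}^{2n}$ the Euclidean unit sphere. Functions are real-valued. *)

(* Defs.v *)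
From HB Require Import structures.
From mathcomp Require Import all_boot all_order all_algebra.
From mathcomp Require Import all_classical all_reals all_analysis.
Set Implicit Arguments. Unset Strict Implicit. Unset Printing Implicit Defensive.
Import Order.TTheory GRing.Theory Num.Theory.
Import numFieldNormedType.Exports.
Local Open Scope classical_set_scope.
Local Open Scope ring_scope.

Section Heis.
Variable R : realType.

Notation V k := 'rV[R]_k.

Definition edot k (a b : V k) : R := \sum_(j < k) a 0 j * b 0 j.
Definition enorm k (a : V k) : R := Num.sqrt (edot a a).

Definition bdry k (A : set (V k)) : set (V k) := closure A `\` interior A.

Definition dist_bd k (A : set (V k)) (xi : V k) : R :=
  inf [set enorm (xi - eta) | eta in bdry A].

Definition econvex k (A : set (V k)) : Prop :=
  forall a b t, A a -> A b -> 0 <= t <= 1 -> A ((1 - t) *: a + t *: b).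

Fixpoint iterD k (vs : seq (V k)) (f : V k -> R) : V k -> R :=
  match vs with
  | [::] => f
  | v :: vs' => fun x => 'D_v (iterD vs' f) x
  end.

Definition smooth k (f : V k -> R) : Prop :=
  forall (vs : seq (V k)) (x : V k), differentiable (iterD vs f) x.

Definition Cc_inf k (A : set (V k)) (f : V k -> R) : Prop :=
  smooth f /\ exists K : set (V k), [/\ compact K, K `<=` A &
                                        forall x, ~ K x -> f x = 0].

(* Lebesgue integral on R^k as iterated one-dimensional Lebesgue integrals *)
Fixpoint iint (k : nat) : (V k -> \bar R) -> \bar R :=
  match k return (V k -> \bar R) -> \bar R with
  | 0 => fun f => f 0
  | k'.+1 => fun f =>
      (\int[@lebesgue_measure R]_(x in setT)
         iint (fun v : V k' => f (row_mx (\row_(_ < 1) x) v)))%E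
  end.

Definition int_on k (A : set (V k)) (f : V k -> \bar R) : \bar R :=
  iint (fun x => if `[< A x >] then f x else 0%E).

(* Heisenberg group H^n = R^(2n+1), coordinates (x_1..x_n, y_1..y_n, t) *)
Definition N n := (n + n).+1.
Definition ix n (i : 'I_n) : 'I_(N n) := inord i.
Definition iy n (i : 'I_n) : 'I_(N n) := inord (n + i).
Definition it n : 'I_(N n) := inord (n + n).

Definition evec k (j : 'I_k) : V k := \row_(l < k) (if l == j then 1 else 0).
Definition partial k (j : 'I_k) (u : V k -> R) (xi : V k) : R := 'D_(evec j) u xi.

(* coefficient vectors of X_i = d_{x_i} + 2 y_i d_t, Y_i = d_{y_i} - 2 x_i d_t *)
Definition Xvec n (i : 'I_n) (xi : V (N n)) : V (N n) :=
  evec (ix i) + (2 * xi 0 (iy i)) *: evec (it n).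
Definition Yvec n (i : 'I_n) (xi : V (N n)) : V (N n) :=
  evec (iy i) - (2 * xi 0 (ix i)) *: evec (it n).

Definition Xop n (i : 'I_n) (u : V (N n) -> R) (xi : V (N n)) : R :=
  partial (ix i) u xi + 2 * xi 0 (iy i) * partial (it n) u xi.
Definition Yop n (i : 'I_n) (u : V (N n) -> R) (xi : V (N n)) : R :=
  partial (iy i) u xi - 2 * xi 0 (ix i) * partial (it n) u xi.

Definition hgrad_norm n (u : V (N n) -> R) (xi : V (N n)) : R :=
  Num.sqrt (\sum_(i < n) (Xop i u xi ^+ 2 + Yop i u xi ^+ 2)).

End Heis.

(* Main.v *)
(** Every field [W] among [+-X_i], [+-Y_i] is constant along its own integral
    curves, which are straight lines, and its flow [xi + s W xi] is a triangular
    shear, hence preserves iterated integrals.  Let [g xi] be the reciprocal of the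
    time at which the line from [xi] in direction [W xi] leaves [Omega]: it is
    continuous on [Omega] and satisfies [W g = g^2].  The function
    [|u|^p g^(p-1)] is then continuous with compact support, so its derivative
    along [W] has integral [0], and adding a multiple of these derivatives for [W]
    and [-W] to [|W u|^p] gives, by Young's inequality, a pointwise upper bound of
    [((p-1)/p)^p max(g_W, g_(-W))^p |u|^p].  Convexity enters through the
    supporting hyperplane at a nearest boundary point: the line leaves [Omega] no
    later than it crosses that hyperplane, i.e.
    [|<W, nu>| / dist <= max(g_W, g_(-W))].  Summing over the fields and using
    [sum |a_j|^p <= (sum a_j^2)^(p/2)] for [p >= 2] ends the proof.  Only continuous
    compactly supported functions are ever integrated, apart from the left-hand
    side, for which monotonicity is enough. *)
Require Import Defs.
From HB Require Import structures.
From mathcomp Require Import all_boot all_order all_algebra.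
From mathcomp Require Import all_classical all_reals all_analysis.
From mathcomp Require Import ring lra.
Set Implicit Arguments. Unset Strict Implicit. Unset Printing Implicit Defensive.
Import Order.TTheory GRing.Theory Num.Theory.
Import numFieldNormedType.Exports.
Local Open Scope classical_set_scope.
Local Open Scope ring_scope.

(** * Iterated integrals of compactly supported functions *)

Section OneDim.
Variable R : realType.
Notation mu := (@lebesgue_measure R).
Implicit Types (h : R -> R) (M a b c C : R).

Definition cc1 M h := continuous h /\ (forall x, M < `|x| -> h x = 0).

Lemma cc1_patch M h a b : cc1 M h -> a <= - M -> M <= b ->
  h \_ `[a, b]%classic = h.
Proof.
move=> [_ hM] aM Mb; apply/funext => x; rewrite patchE; case: ifPn => //.
move=> xab; apply/esym/hM; rewrite ltNge; apply: contraNN xab.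
rewrite ler_norml => /andP[x1 x2]; apply/mem_set; rewrite /= in_itv/=.
by apply/andP; split; [exact: le_trans x1|exact: le_trans Mb].
Qed.

Lemma cc1_integrable M h : cc1 M h -> mu.-integrable setT (EFin \o h).
Proof.
move=> ch; rewrite -(cc1_patch ch (lexx _) (lexx _)) -restrict_EFin.
have hi : mu.-integrable `[- M, M] (EFin \o h).
  apply: continuous_compact_integrable; first exact: segment_compact.
  by apply: continuous_subspaceT; case: ch.
by move: hi => /integrable_mkcond; apply.
Qed.

Lemma cc1_Rintegral M h a b : cc1 M h -> a <= - M -> M <= b ->
  \int[mu]_x h x = \int[mu]_(x in `[a, b]) h x.
Proof.
move=> ch aM Mb; rewrite [RHS]Rintegral_mkcond; congr Rintegral.
by rewrite (cc1_patch ch).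
Qed.

Lemma cc1_le_norm M C h : 0 <= M -> cc1 M h -> (forall x, `|h x| <= C) ->
  `|\int[mu]_x h x| <= 2 * M * C.
Proof.
move=> M0 ch hC; rewrite (cc1_Rintegral ch (lexx _) (lexx _)).
have hi : mu.-integrable `[- M, M] (EFin \o h).
  by apply: integrableS (cc1_integrable ch).
apply: (le_trans (le_normr_Rintegral _ _)) => //.
have Ci : mu.-integrable `[- M, M] (EFin \o (fun=> C)).
  apply: continuous_compact_integrable; first exact: segment_compact.
  by apply: continuous_subspaceT => x; exact: cst_continuous.
apply: (@le_trans _ _ (\int[mu]_(x in `[- M, M]) C)).
  by apply: le_Rintegral => //; exact: integrable_norm hi.
rewrite Rintegral_cst//.
rewrite (_ : fine _ = fine (mu `[- M, M]%classic)) // lebesgue_measure_itv /= lte_fin.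
case: ifPn => [_|].
  rewrite -EFinD /= opprK mulrC [X in _ <= X * _](_ : _ = M + M) //.
  by ring.
move=> _; rewrite mulr0; rewrite !mulr_ge0//.
by rewrite (le_trans _ (hC 0)).
Qed.

Lemma cc1_translate M h c : cc1 M h -> \int[mu]_x h (x + c) = \int[mu]_x h x.
Proof.
move=> ch; have cch : cc1 (M + `|c|) (fun x => h (x + c)).
  split; last first.
    move=> x Mx; apply: ch.2; rewrite -(ltrD2r `|c|) (lt_le_trans Mx)//.
    by rewrite -[in leLHS](addrK c x) ler_normB.
  move=> x; apply: continuous_comp; last exact: ch.1.
  by apply: continuousD => //; exact: cst_continuous.
(* [[- B, B]] contains the support of the translate, and its image [[- B + c, B + c]] under the
   shift contains that of [h]. *)
pose B := `|M| + `|c| + `|c|.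
have N1 := ler_norm M; have N2 := ler_norm c; have N4 : 0 <= `|c| by [].
have N5 : 0 <= `|M| by [].
have N3 : - c <= `|c| by rewrite -normrN ler_norm.
rewrite (cc1_Rintegral cch (a := - B) (b := B)); [|rewrite /B; lra..].
rewrite (cc1_Rintegral ch (a := - B + c) (b := B + c)); [|rewrite /B; lra..].
have dF x : is_derive x (1 : R) (fun y : R => y + c) 1.
  by apply: is_derive_shift.
have F1 : (fun y : R => y + c)^`()%classic = cst 1.
  by apply/funext => x; rewrite derive1E (@derive_val _ _ _ _ _ _ _ (dF x)).
rewrite /Rintegral; congr fine.
rewrite (@integration_by_substitution_increasing _ (fun y => y + c) h (- B) B).
- by rewrite F1; apply: eq_integral => x _; rewrite /= !fctE mulr1.
- rewrite /B; lra.
- by move=> x y _ _; rewrite ltrD2r.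
- by rewrite F1 => x _; exact: cst_continuous.
- by rewrite F1; exact: is_cvg_cst.
- by rewrite F1; exact: is_cvg_cst.
- split.
  + by move=> x _; exact: (@ex_derive _ _ _ _ _ _ _ (dF x)).
  + by apply: cvgD; [apply: cvg_at_right_filter; exact: cvg_id|exact: cvg_cst].
  + by apply: cvgD; [apply: cvg_at_left_filter; exact: cvg_id|exact: cvg_cst].
- by apply: continuous_subspaceT; exact: ch.1.
Qed.

(* No measurability is needed: the integral of a nonnegative function is a
   supremum over the simple functions below it.  This matters because [nu] is an
   arbitrary selection of normals. *)
Lemma le_integral_ge0 (f g : R -> \bar R) :
  (forall x, 0 <= f x)%E -> (forall x, f x <= g x)%E ->
  (\int[mu]_x f x <= \int[mu]_x g x)%E.
Proof.
move=> f0 fg; have g0 x : (0 <= g x)%E by exact: le_trans (fg x).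
rewrite !ge0_integralTE//; apply: ereal_sup_le => _ [h hf <-].
by exists h => // x; exact: le_trans (fg x).
Qed.

End OneDim.

Section MultiDim.
Variable R : realType.
Notation mu := (@lebesgue_measure R).
Notation V k := 'rV[R]_k.
Implicit Types (M a x C : R).

Definition consv k (x : R) (v : V k) : V k.+1 := row_mx (\row_(_ < 1) x) v.

Lemma consv0 k x (v : V k) : consv x v 0 0 = x.
Proof.
have := row_mxEl (\row_(_ < 1) x) v 0 0; rewrite [RHS]mxE; apply: etrans.
by rewrite /consv; congr (row_mx _ _ _ _); exact: val_inj.
Qed.

Lemma consvS k x (v : V k) j : consv x v 0 (lift 0 j) = v 0 j.
Proof.
rewrite -[RHS](row_mxEr (\row_(_ < 1) x) v 0 j) /consv.
by congr (row_mx _ _ _ _); exact: val_inj.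
Qed.

(** The real-valued counterpart of [iint]: linearity becomes an equation free of infinite values. On
    [cc] functions [iint_rint] identifies the two. *)
Fixpoint rint (k : nat) : (V k -> R) -> R :=
  match k return (V k -> R) -> R with
  | 0 => fun f => f 0
  | k'.+1 => fun f => \int[mu]_x rint (fun v : V k' => f (consv x v))
  end.

(* Uniform continuity is used instead of continuity: it passes to slices, and
   the slices of [f] are then uniformly close to each other. *)
Definition cc k (M : R) (f : V k -> R) :=
  (forall e : R, 0 < e -> exists2 d : R, 0 < d &
     forall v w : V k, (forall j, `|v 0 j - w 0 j| < d) -> `|f v - f w| < e) /\
  (forall (v : V k) j, M < `|v 0 j| -> f v = 0).

Lemma cc_slice k M (f : V k.+1 -> R) x : cc M f -> cc M (fun v => f (consv x v)).
Proof.
move=> [fu f0]; split=> [e /fu[d d0 H]|v j Mv].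
  exists d => // v w vw; apply: H => j; have [j' ->|->] := unliftP 0 j.
    by rewrite !consvS.
  by rewrite !consv0 subrr normr0.
by apply: (f0 _ (lift 0 j)); rewrite consvS.
Qed.

Lemma ccD k M (f g : V k -> R) : cc M f -> cc M g -> cc M (fun v => f v + g v).
Proof.
move=> [fu f0] [gu g0]; split=> [e e0|v j Mv]; last first.
  by rewrite (f0 _ _ Mv) (g0 _ _ Mv) addr0.
have e20 : 0 < e / 2 by rewrite divr_gt0.
have [d d0 Hd] := fu _ e20; have [d' d'0 Hd'] := gu _ e20.
exists (Num.min d d'); first by rewrite lt_min d0.
move=> v w vw; rewrite opprD addrACA (splitr e).
rewrite (le_lt_trans (ler_normD _ _))// ltrD//.
  by apply: Hd => j; move: (vw j); rewrite lt_min => /andP[].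
by apply: Hd' => j; move: (vw j); rewrite lt_min => /andP[].
Qed.

Lemma ccZ k M a (f : V k -> R) : cc M f -> cc M (fun v => a * f v).
Proof.
move=> [fu f0]; split=> [e e0|v j Mv]; last by rewrite (f0 _ _ Mv) mulr0.
have a0 : 0 < `|a| + 1 by rewrite ltr_wpDl.
have [d d0 Hd] := fu _ (divr_gt0 e0 a0); exists d => // v w /Hd fvw.
rewrite -mulrBr normrM (@le_lt_trans _ _ ((`|a| + 1) * `|f v - f w|))//.
  by rewrite ler_wpM2r// lerDl.
by rewrite mulrC -ltr_pdivlMr.
Qed.

Lemma cc_le k M M' (f : V k -> R) : M <= M' -> cc M f -> cc M' f.
Proof. by move=> MM' [fu f0]; split=> // v j /(le_lt_trans MM'); exact: f0. Qed.

(** Heine-Cantor: compactness of the box, as [near_covering], gives one [d] for all its points. If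
    only one of two points is in the box, symmetry applies; if neither is, [f] vanishes at both. *)
Lemma continuous_cc k M (f : V k -> R) : continuous f ->
  (forall (v : V k) j, M < `|v 0 j| -> f v = 0) -> cc M f.
Proof.
move=> cf f0; split=> // e e0.
pose box : set (V k) := [set v | forall j, `[- M, M]%classic (v ord0 j)].
have cbox : compact box.
  by apply: (@rV_compact R k (fun=> `[- M, M]%classic)) => j; exact: segment_compact.
have : near_covering box by apply/compact_near_coveringP.
pose P (d : R) (v : V k) := forall w, ball v d w -> `|f v - f w| < e.
move=> nc; have [v bv|d0 /= d00 H] := nc R (0 : R)^'+ P (at_right_proper_filter 0).
  have e20 : 0 < e / 2 by rewrite divr_gt0.
  have /cvgrPdist_lt/(_ _ e20)/nbhs_ballP[r /= r0 Hr] := cf v.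
  have r20 : 0 < r / 2 by rewrite divr_gt0.
  exists (ball v (r / 2), [set d | d < r / 2]); first split => /=.
  - exact: nbhsx_ballx.
  - exact: nbhs_right_lt.
  - move=> [v' d] /= [vv' dr] w v'w.
    have H1 : `|f v - f v'| < e / 2.
      by apply: Hr; apply: le_ball vv'; lra.
    have H2 : `|f v - f w| < e / 2.
      apply: Hr; rewrite [r]splitr; apply: ball_triangle vv' _.
      by apply: le_ball v'w; exact: ltW.
    rewrite [e]splitr (le_lt_trans (ler_distD (f v) _ _))// ltrD// distrC//.
pose d : R := Num.min d0 1 / 2.
have m0 : 0 < Num.min d0 1 by rewrite lt_min d00 ltr01.
have d1 : 0 < d by rewrite divr_gt0.
have {}H (v w : V k) : box v -> (forall j, `|v 0 j - w 0 j| < d) -> `|f v - f w| < e.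
  move=> bv vw; apply: (H d _ d1 v bv) => /=.
    rewrite sub0r normrN gtr0_norm// /d.
    have : Num.min d0 1 <= d0 by rewrite ge_min lexx.
    lra.
  by split => // i j; rewrite ord1; exact: vw.
exists d => // v w vw.
have [bv|nbv] := pselect (box v); first exact: H.
have [bw|nbw] := pselect (box w).
  by rewrite distrC; apply: H => // j; rewrite distrC.
have out z : ~ box z -> f z = 0.
  move=> /existsNP[j]; rewrite /= in_itv/= -ler_norml => /negP; rewrite -ltNge.
  exact: f0.
by rewrite !out// subrr normr0.
Qed.

(** The three properties go through one induction: integrability of slice integrals in dimension
    [k + 1] rests on their continuity, which uses all three in dimension [k]. *)
Definition rint_linear_bound k M :=
  [/\ forall f g : V k -> R, cc M f -> cc M g ->
        rint (fun v => f v + g v) = rint f + rint g,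
      forall a (f : V k -> R), cc M f -> rint (fun v => a * f v) = a * rint f &
      forall (C : R) (f : V k -> R), cc M f -> (forall v, `|f v| <= C) ->
        `|rint f| <= (2 * M) ^+ k * C].

(** Slices over nearby [x] are uniformly close, so by linearity their integrals differ by the
    integral of a small function. *)
Lemma rint_linear_bound_slice k M (f : V k.+1 -> R) : 0 <= M ->
  rint_linear_bound k M -> cc M f ->
  cc1 M (fun x => rint (fun v => f (consv x v))).
Proof.
move=> M0 [HD HZ HC] cf; split.
  move=> x; apply/cvgrPdist_le => e e0.
  have [d d0 Hd] : exists2 d, 0 < d & forall y v, `|x - y| < d ->
      `|f (consv x v) - f (consv y v)| <= e / ((2 * M) ^+ k + 1).
    have P0 : 0 < (2 * M) ^+ k + 1 by rewrite ltr_wpDl// exprn_ge0// mulr_ge0.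
    have [d d0 Hd] := cf.1 _ (divr_gt0 e0 P0).
    exists d => // y v xy; apply/ltW/Hd => j.
    have [j' ->|->] := unliftP 0 j; first by rewrite !consvS subrr normr0.
    by rewrite !consv0.
  near=> y; have xy : `|x - y| < d.
    by near: y; exact: (@cvgr_dist_lt _ _ _ _ _ id x).
  have cfx z := cc_slice z cf.
  have := HC (e / ((2 * M) ^+ k + 1)) _ (ccD (cfx x) (ccZ (-1) (cfx y))).
  rewrite HD//; last exact: ccZ.
  rewrite HZ// mulN1r => H; apply: (le_trans (H _)) => [v|].
    by rewrite mulN1r; exact: Hd.
  have P0 : 0 <= (2 * M) ^+ k by rewrite exprn_ge0// mulr_ge0.
  rewrite mulrCA ler_piMr ?(ltW e0)// ler_pdivrMr ?mul1r ?lerDl//.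
  by rewrite ltr_wpDl.
(* The slice is zero, hence 0 times itself, and homogeneity gives integral 0. *)
move=> x Mx; rewrite (_ : (fun v => _) = (fun v => 0 * f (consv x v))).
  by rewrite HZ ?mul0r//; exact: cc_slice.
by apply/funext => v; rewrite mul0r (cf.2 _ 0)// consv0.
Unshelve. all: by end_near. Qed.

Lemma rint_linear_boundP k M : 0 <= M -> rint_linear_bound k M.
Proof.
move=> M0; elim: k => [|k IH].
  by split=> // C f _ /(_ 0); rewrite expr0 mul1r.
have [HD HZ HC] := IH; have H1 f := @rint_linear_bound_slice k M f M0 IH.
split.
- move=> f g cf cg /=; rewrite -RintegralD//; last 2 first.
    exact: cc1_integrable (H1 _ cf).
    exact: cc1_integrable (H1 _ cg).
  by apply: eq_Rintegral => x _; rewrite HD//; exact: cc_slice.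
- move=> a f cf /=; rewrite -RintegralZl//; last exact: cc1_integrable (H1 _ cf).
  by apply: eq_Rintegral => x _; rewrite HZ//; exact: cc_slice.
- move=> C f cf fC /=; rewrite exprS -mulrA.
  apply: cc1_le_norm (H1 _ cf) _ => // x.
  by apply: HC => //; exact: cc_slice.
Qed.

Lemma rintD k M (f g : V k -> R) : 0 <= M -> cc M f -> cc M g ->
  rint (fun v => f v + g v) = rint f + rint g.
Proof. by move=> /(@rint_linear_boundP k)[+ _ _]; apply. Qed.

Lemma rintZ k M a (f : V k -> R) : 0 <= M -> cc M f ->
  rint (fun v => a * f v) = a * rint f.
Proof. by move=> /(@rint_linear_boundP k)[_ + _]; apply. Qed.

Lemma rint_le_norm k M C (f : V k -> R) : 0 <= M -> cc M f ->
  (forall v, `|f v| <= C) -> `|rint f| <= (2 * M) ^+ k * C.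
Proof. by move=> /(@rint_linear_boundP k)[_ _ +]; apply. Qed.

Lemma cc1_rint_slice k M (f : V k.+1 -> R) : 0 <= M -> cc M f ->
  cc1 M (fun x => rint (fun v => f (consv x v))).
Proof. by move=> M0; apply: rint_linear_bound_slice => //; exact: rint_linear_boundP. Qed.

Lemma eq_rint k (f g : V k -> R) : f =1 g -> rint f = rint g.
Proof. by move=> /funext ->. Qed.

Lemma cc0 k M : cc M (fun _ : V k => 0).
Proof.
by split=> // e e0; exists 1 => // v w _; rewrite subrr normr0.
Qed.

Lemma cc_rint_sum k M (I : Type) (s : seq I) (f : I -> V k -> R) : 0 <= M ->
  (forall i, cc M (f i)) ->
  cc M (fun v => \sum_(i <- s) f i v) /\
  rint (fun v => \sum_(i <- s) f i v) = \sum_(i <- s) rint (f i).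
Proof.
move=> M0 fM; elim: s => [|a s [cs IH]].
  under [fun v => _]eq_fun do rewrite big_nil.
  rewrite big_nil; split; first exact: cc0.
  by have := rintZ 0 M0 (@cc0 k M); rewrite !mul0r.
under [fun v => _]eq_fun do rewrite big_cons.
by rewrite big_cons -IH; split; [exact: ccD|exact: (rintD M0 (fM a) cs)].
Qed.

Lemma iint_rint k M (f : V k -> R) : 0 <= M -> cc M f ->
  iint (fun v => (f v)%:E) = (rint f)%:E.
Proof.
move=> M0; elim: k f => [//|k IH] f cf /=.
under eq_integral => x _ do rewrite (IH _ (cc_slice x cf)).
rewrite fineK//; apply: integrable_fin_num => //.
exact: cc1_integrable (cc1_rint_slice M0 cf).
Qed.

Lemma iint_ge0 k (f : V k -> \bar R) : (forall v, 0 <= f v)%E -> (0 <= iint f)%E.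
Proof.
elim: k f => [//|k IH] f f0 /=; first exact: f0.
by apply: integral_ge0 => x _; exact: IH.
Qed.

Lemma le_iint k (f g : V k -> \bar R) :
  (forall v, 0 <= f v)%E -> (forall v, f v <= g v)%E -> (iint f <= iint g)%E.
Proof.
elim: k f g => [|k IH] f g f0 fg /=; first exact: fg.
apply: le_integral_ge0 => x; first exact: iint_ge0.
exact: IH.
Qed.

(* Once the earlier coordinates are fixed, each coordinate is only translated;
   this replaces Fubini's theorem and the change of variables formula. *)
Lemma rint_shear k M (tau : V k -> V k) (f : V k -> R) : 0 <= M ->
  (forall (v w : V k) (j : 'I_k), (forall l : 'I_k, (l < j)%N -> v 0 l = w 0 l) ->
     tau v 0 j = tau w 0 j) ->
  cc M f -> rint (fun v => f (v + tau v)) = rint f.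
Proof.
move=> M0; elim: k tau f => [|k IH] tau f htau cf /=.
  by congr f; apply/rowP => -[].
(* No coordinate precedes the first, so the first entry of [tau] is the constant [c]. Once it is
   shifted away, the other entries form a triangular shear [tau'] in dimension [k]. *)
pose c := tau 0 0 0.
rewrite -(cc1_translate c (cc1_rint_slice M0 cf)).
apply: eq_Rintegral => x _ /=.
pose tau' (v : V k) : V k := \row_j tau (consv x v) 0 (lift 0 j).
rewrite -(IH tau' _ _ (cc_slice (x + c) cf)); last first.
  move=> v w j vw; rewrite !mxE; apply: htau => l lj.
  have [l' ll|->] := unliftP 0 l; last by rewrite !consv0.
  by rewrite ll !consvS; apply: vw; move: lj; rewrite ll.
apply: eq_rint => v; congr f; apply/rowP => j.
have [j' ->|->] := unliftP 0 j; first by rewrite mxE !consvS !mxE.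
by rewrite mxE !consv0; congr (_ + _); exact: htau.
Qed.

End MultiDim.

(* Otherwise unification unfolds [rint] on the concrete dimension [N n]. *)
Opaque rint.

(** * Gauges of open convex sets *)

Section Gauge.
Variable R : realType.
Notation V k := 'rV[R]_k.
Implicit Types (l s t e : R).

Lemma near_open (S T : topologicalType) (A : set T) (f : S -> T) (x : S) :
  open A -> {for x, continuous f} -> A (f x) -> \forall z \near x, A (f z).
Proof. by move=> oA cf Af; apply: cf; exact: open_nbhs_nbhs. Qed.

Lemma continuousDZ (S : topologicalType) (W : normedModType R) (f g : S -> W)
    (a : R) (x : S) : {for x, continuous f} -> {for x, continuous g} ->
  {for x, continuous (fun z => f z + a *: g z)}.
Proof.
by move=> cf cg; apply: cvgD; [exact: cf|apply: cvgZl_tmp; exact: cg].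
Qed.

Lemma semicontinuous_continuous (S : topologicalType) (f : S -> R) (x : S) :
  (forall l, f x < l -> \forall z \near x, f z <= l) ->
  (forall l, l < f x -> \forall z \near x, l <= f z) ->
  {for x, continuous f}.
Proof.
move=> up lo; apply/cvgrPdist_le => e e0; near=> z.
rewrite ler_distlC; apply/andP; split; near: z.
  by apply: lo; rewrite ltrBlDr ltrDl.
by apply: up; rewrite ltrDl.
Unshelve. all: by end_near. Qed.

(* [1 / gauge A x w] is the time at which the ray [x + r w] leaves [A]; the gauge
   is [0] exactly when it never does (for [x] in [A] open and convex). *)
Definition gauge k (A : set (V k)) (x w : V k) : R :=
  inf [set l | 0 < l /\ A (x + l^-1 *: w)].

Section convex_open.
Variables (k : nat) (A : set (V k)).
Hypotheses (oA : open A) (cA : econvex A).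
Implicit Types x w : V k.

Let gset x w : set R := [set l | 0 < l /\ A (x + l^-1 *: w)].

Lemma gauge_le x w l : 0 < l -> A (x + l^-1 *: w) -> gauge A x w <= l.
Proof.
move=> l0 Al; apply: ge_inf; last by split.
by exists 0 => y [/ltW].
Qed.

Lemma has_inf_gauge x w : A x -> has_inf (gset x w).
Proof.
move=> Ax; split; last by exists 0 => y [/ltW].
have : \forall t \near (0 : R), A (x + t *: w).
  apply: (near_open oA (f := fun t : R => x + t *: w)); last first.
    by rewrite scale0r addr0.
  apply: (@cvgD _ (V k)); first exact: cvg_cst.
  by apply: (@cvgZr_tmp _ (V k)); exact: cvg_id.
move=> /nbhs_ballP[r /= r0 Hr]; pose t : R := r / 2.
have t0 : 0 < t by rewrite divr_gt0.
have At : A (x + t *: w).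
  by apply: Hr; rewrite /ball/= sub0r normrN gtr0_norm// /t; lra.
by exists t^-1; split; rewrite ?invr_gt0// invrK.
Qed.

Lemma gauge_ge0 x w : A x -> 0 <= gauge A x w.
Proof. by move=> /(has_inf_gauge w)[ne _]; apply: lb_le_inf => // y [/ltW]. Qed.

(** Some admissible [l'] is below [l], and by convexity the segment from [x] to the point for [l']
    contains the point for [l]. *)
Lemma gauge_lt x w l : A x -> gauge A x w < l -> A (x + l^-1 *: w).
Proof.
move=> Ax gl; have hi := has_inf_gauge w Ax.
have [l' [l'0 Al'] l'l] := inf_lt hi.1 gl.
have l0 : 0 < l by exact: lt_trans l'l.
have -> : x + l^-1 *: w = (1 - l' / l) *: x + (l' / l) *: (x + l'^-1 *: w).
  rewrite scalerDr scalerA addrA -scalerDl subrK scale1r.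
  by rewrite mulrAC divff ?gt_eqF// mul1r.
by apply: cA => //; rewrite divr_ge0 ?(ltW l'0) ?(ltW l0)//= ler_pdivrMr// mul1r ltW.
Qed.

(** Moving by [s] shortens the exit time by [s]. Multiplied out, this also covers gauge 0; it is the
    integrated form of [W g = g^2]. The inequality [half] is used from [x] with [s] and from
    [x + s *: w] with [- s]. *)
Lemma gauge_shift x w s : A x -> A (x + s *: w) ->
  gauge A (x + s *: w) w * (1 - s * gauge A x w) = gauge A x w.
Proof.
have half y r : A y -> A (y + r *: w) ->
    gauge A y w <= gauge A (y + r *: w) w * (1 - r * gauge A y w).
  move=> Ay Ar; set g := gauge A y w; set g' := gauge A _ w.
  have g0 : 0 <= g by exact: gauge_ge0.
  have H l : g' < l -> g <= l * (1 - r * g).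
    move=> g'l; have l0 : 0 < l by apply: le_lt_trans g'l; exact: gauge_ge0.
    have := gauge_lt Ar g'l; rewrite -addrA -scalerDl => Al.
    have [rl|rl] := ltP 0 (r + l^-1).
      have /gauge_le : A (y + ((r + l^-1)^-1)^-1 *: w) by rewrite invrK.
      rewrite invr_gt0 => /(_ rl); rewrite -/g -[_^-1]mul1r ler_pdivlMr// => gr1.
      rewrite -subr_ge0; have -> : l * (1 - r * g) - g = l * (1 - g * (r + l^-1)).
        by field; rewrite gt_eqF.
      by rewrite mulr_ge0 ?(ltW l0)// subr_ge0.
    (* Here the point for [l] is not ahead of [y]: [l * r <= -1], which already gives the bound. *)
    have l10 : 0 < l^-1 by rewrite invr_gt0.
    have : l * (r + l^-1) <= 0 by rewrite pmulr_rle0.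
    by rewrite mulrDr divff ?gt_eqF// => lr; nra.
  apply/ler_addgt0Pr => e e0.
  (* A nonpositive factor would force [g = 0] through [H], and then the factor is 1. *)
  have [P0|P0] := ltP 0 (1 - r * g); last first.
    have g'0 : 0 <= g' by exact: gauge_ge0.
    have := H (g' + 1); rewrite ltrDl ltr01 => /(_ isT) gP.
    have gE : g = 0 by apply/eqP; rewrite eq_le g0 andbT (le_trans gP)// mulr_ge0_le0// addr_ge0.
    by move: P0; rewrite gE mulr0 subr0 ler10.
  have := H (g' + e / (1 - r * g)); rewrite ltrDl divr_gt0// => /(_ isT).
  by rewrite mulrDl divfK// gt_eqF.
move=> Ax As; apply/eqP; rewrite eq_le half// andbT.
have := half (x + s *: w) (- s) As; rewrite scaleNr addrK => /(_ Ax); nra.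
Qed.

(** Upper semicontinuity is openness of [A]. For the lower one, a gauge below [l < g] at points [z]
    near [x] would, by convexity, put [x + m^-1 *: w x] in [A] for an [m] between [l] and [g]. *)
Lemma gauge_continuous x (w : V k -> V k) : A x -> {for x, continuous w} ->
  {for x, continuous (fun z => gauge A z (w z))}.
Proof.
move=> Ax cw; set g := gauge A x (w x).
have g0 : 0 <= g by exact: gauge_ge0.
have up l : g < l -> \forall z \near x, gauge A z (w z) <= l.
  move=> gl; have l0 : 0 < l by exact: le_lt_trans gl.
  have : \forall z \near x, A (z + l^-1 *: w z).
    apply: (@near_open (V k) (V k) A (fun z => z + l^-1 *: w z) x oA); last exact: gauge_lt.
    by apply: (@continuousDZ (V k) (V k) id w).
  by apply: filterS => z; exact: gauge_le.
have lo l : l < g -> \forall z \near x, l <= gauge A z (w z).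
  move=> lg; have nAx : \forall z \near x, A z by exact: open_nbhs_nbhs.
  have [l0|l0] := leP l 0.
    by apply: filterS nAx => z Az; apply: (le_trans l0); exact: gauge_ge0.
  pose m := (l + g) / 2; pose th := l / m.
  have m0 : 0 < m by rewrite /m; lra.
  have lm : l < m by rewrite /m; lra.
  have th1 : th < 1 by rewrite ltr_pdivrMr// mul1r.
  have nP : ~ A (x + m^-1 *: w x).
    by move=> /gauge_le => /(_ m0); rewrite -/g /m; lra.
  (* [x + w x / m] lies on the segment from [z' z] to [z + w z / l]. *)
  pose z' z := (1 - th)^-1 *: (x + m^-1 *: w x) +
    (- ((1 - th)^-1 * th)) *: z + (- ((1 - th)^-1 * m^-1)) *: w z.
  have th10 : 1 - th != 0 by rewrite gt_eqF// subr_gt0.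
  have z'E z : z' z = (1 - th)^-1 *: (x + m^-1 *: w x - th *: z - m^-1 *: w z).
    by rewrite /z' !scalerBr !scaleNr !scalerA.
  have z'x : z' x = x.
    rewrite z'E addrAC addrK (_ : x - th *: x = (1 - th) *: x).
      by rewrite scalerA mulVf// scale1r.
    by rewrite scalerBl scale1r.
  have nz' : \forall z \near x, A (z' z).
    apply: (@near_open (V k) (V k) A z' x oA); last by rewrite z'x.
    apply: (@continuousDZ (V k) (V k)); last exact: cw.
    by apply: (@continuousDZ (V k) (V k) (cst _) id) => //; exact: cst_continuous.
  near=> z; have Az' : A (z' z) by near: z.
  rewrite leNgt; apply/negP => gl; apply: nP.
  have Az : A z by near: z.
  have -> : x + m^-1 *: w x = (1 - th) *: z' z + th *: (z + l^-1 *: w z).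
    rewrite z'E scalerA divff// scale1r scalerDr scalerA.
    rewrite (_ : th * l^-1 = m^-1); last by rewrite /th mulrAC divff ?mul1r ?gt_eqF.
    by rewrite [RHS]addrACA subrK addNr addr0.
  apply: cA => //; first exact: gauge_lt.
  by rewrite divr_ge0 ?(ltW m0) ?(ltW l0)//= ltW.
exact: (@semicontinuous_continuous (V k) (fun z => gauge A z (w z)) x).
Unshelve. all: by end_near. Qed.

End convex_open.
End Gauge.

(** * Distance to the boundary of a convex set *)

Section Geometry.
Variable R : realType.
Notation V k := 'rV[R]_k.
Implicit Types (s t : R).

Lemma edotC k (a b : V k) : edot a b = edot b a.
Proof. by apply: eq_bigr => j _; rewrite mulrC. Qed.

Lemma edotDl k (a b c : V k) : edot (a + b) c = edot a c + edot b c.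
Proof. by rewrite -big_split; apply: eq_bigr => j _; rewrite mxE mulrDl. Qed.

Lemma edotZl k s (a b : V k) : edot (s *: a) b = s * edot a b.
Proof. by rewrite mulr_sumr; apply: eq_bigr => j _; rewrite mxE mulrA. Qed.

Lemma edotNl k (a b : V k) : edot (- a) b = - edot a b.
Proof. by rewrite -scaleN1r edotZl mulN1r. Qed.

Lemma edotDr k (a b c : V k) : edot c (a + b) = edot c a + edot c b.
Proof. by rewrite !(edotC c) edotDl. Qed.

Lemma edotZr k s (a b : V k) : edot b (s *: a) = s * edot b a.
Proof. by rewrite !(edotC b) edotZl. Qed.

Lemma edotNr k (a b : V k) : edot b (- a) = - edot b a.
Proof. by rewrite !(edotC b) edotNl. Qed.

Lemma edot_ge0 k (a : V k) : 0 <= edot a a.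
Proof. by apply: sumr_ge0 => j _; exact: sqr_ge0. Qed.

Lemma edot_eq0 k (a : V k) : (edot a a == 0) = (a == 0).
Proof.
apply/eqP/eqP => [|->]; last first.
  by rewrite /edot big1// => j _; rewrite mxE mul0r.
move=> /eqP; rewrite psumr_eq0 => [/allP a0|j _]; last exact: sqr_ge0.
apply/rowP => j; rewrite mxE; apply/eqP.
by have := a0 j (mem_index_enum j); rewrite mulf_eq0 orbb.
Qed.

Lemma enormN k (a : V k) : enorm (- a) = enorm a.
Proof. by rewrite /enorm edotNl edotNr opprK. Qed.

Lemma edot_sqrBZ k s (a b : V k) : edot (a - s *: b) (a - s *: b) =
  edot a a - 2 * (s * edot b a) + s * s * edot b b.
Proof.
rewrite edotDl !edotDr !edotNl !edotNr !edotZl !edotZr (edotC a b); ring.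
Qed.

Section nearest_point.
Variables (k : nat) (A : set (V k)).
Hypotheses (oA : open A) (cA : econvex A).
Implicit Types x w : V k.

(** Just before the exit time the line is in [A]; if it were still in [A] just after, the gauge
    would be smaller than itself. *)
Lemma gauge_bdry x w : A x -> 0 < gauge A x w ->
  bdry A (x + (gauge A x w)^-1 *: w).
Proof.
move=> Ax g0; set g := gauge A x w in g0 *.
have clin : continuous (fun s : R => x + s *: w).
  move=> s; apply: (@cvgD _ (V k)); first exact: cvg_cst.
  by apply: (@cvgZr_tmp _ (V k)); exact: cvg_id.
split; last first.
  rewrite (_ : interior A = A) => [Ag|]; last exact/interior_id.
  have /nbhs_ballP[r /= r0 Hr] : \forall s \near g^-1, A (x + s *: w).
    exact: (@near_open _ (V k)) oA (clin _) Ag.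
  have gi : 0 < g^-1 by rewrite invr_gt0.
  pose l := (g^-1 + r / 2)^-1.
  have /gauge_le : A (x + l^-1 *: w).
    by rewrite invrK; apply: Hr; rewrite /ball/= opprD addrA subrr sub0r normrN gtr0_norm; lra.
  have l0 : 0 < l by rewrite invr_gt0; lra.
  move=> /(_ l0); rewrite -/g leNgt => /negP; apply.
  rewrite -[ltRHS]invrK ltf_pV2 ?posrE//; lra.
move=> B; move: (clin g^-1 B) => /[apply] /nbhs_ballP[r /= r0 Hr].
have gi : 0 < g^-1 by rewrite invr_gt0.
pose s := g^-1 - Num.min (g^-1) r / 2.
have m0 : 0 < Num.min g^-1 r by rewrite lt_min gi.
have m1 : Num.min g^-1 r <= g^-1 by rewrite ge_min lexx.
have m2 : Num.min g^-1 r <= r by rewrite ge_min lexx orbT.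
have s0 : 0 < s by rewrite /s; lra.
exists (x + s *: w); split.
  rewrite -(invrK s); apply: gauge_lt => //.
  rewrite -/g -[ltLHS]invrK ltf_pV2 ?posrE// /s; lra.
by apply: Hr; rewrite /ball/= /s opprB addrC subrK gtr0_norm; lra.
Qed.

(* The hyperplane through a nearest boundary point [y], orthogonal to [y - x],
   supports [A]; the line [x + R w] crosses it at parameter |y - x|^2 / <w, y - x>. *)
Lemma edot_le_gauge x y w : A x -> bdry A y ->
  enorm (x - y) = dist_bd A x ->
  edot w (y - x) <= edot (y - x) (y - x) * gauge A x w.
Proof.
move=> Ax [_ nAy] xy; rewrite (_ : interior A = A) in nAy; last exact/interior_id.
set d := y - x; set D := edot d d.
have D0 : 0 < D.
  rewrite lt_neqAle edot_ge0 andbT eq_sym edot_eq0 subr_eq0.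
  by apply: contra_notN nAy => /eqP ->.
(* The ray from [x] to a point [z] outside [A] meets the boundary no later than [z], hence [z] is at
   least as far from [x] as [y]. *)
have noball z : ~ A z -> D <= edot (z - x) (z - x).
  move=> nAz; have g1 : 1 <= gauge A x (z - x).
    rewrite leNgt; apply/negP => /(gauge_lt oA cA Ax).
    by rewrite invr1 scale1r addrC subrK.
  have g0 : 0 < gauge A x (z - x) by exact: lt_le_trans g1.
  have bg := gauge_bdry Ax g0.
  have : dist_bd A x <= enorm (x - (x + (gauge A x (z - x))^-1 *: (z - x))).
    apply: ge_inf; last by exists (x + (gauge A x (z - x))^-1 *: (z - x)).
    by exists 0 => _ [? _ <-]; exact: sqrtr_ge0.
  rewrite -xy -opprB -/d enormN opprD addrA subrr sub0r enormN.
  rewrite /enorm ler_sqrt ?edot_ge0// => /le_trans; apply.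
  rewrite edotZl edotZr mulrA ler_piMl ?edot_ge0//.
  by rewrite -invfM invf_le1 ?mulr_gt0// mulr_ege1.
rewrite leNgt; apply/negP => gw.
have g0 : 0 <= gauge A x w by exact: gauge_ge0.
have : gauge A x w < edot w d / D by rewrite ltr_pdivlMr// mulrC.
set e := edot w d / D => ge.
(* Strictly between the two values, so that [x + l^-1 *: w] is still in [A] but already beyond the
   hyperplane; [m] leads from [y] to it. *)
pose l := (gauge A x w + e) / 2.
have l0 : 0 < l by rewrite /l; lra.
have Al : A (x + l^-1 *: w) by apply: gauge_lt => //; rewrite /l; lra.
have le : l < e by rewrite /l; lra.
have [m mP] : exists m, m = x + l^-1 *: w - y by eexists.
have mE : m = l^-1 *: w - d by rewrite mP /d opprB addrAC [RHS]addrC.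
have md : 0 < edot m d.
  rewrite mE edotDl edotZl edotNl -/D subr_gt0 mulrC ltr_pdivlMr// mulrC.
  by rewrite -ltr_pdivlMr.
have mm : 0 < edot m m.
  rewrite lt_neqAle edot_ge0 andbT eq_sym edot_eq0.
  apply: contraTN md => /eqP ->; rewrite /edot big1 ?ltxx// => j _.
  by rewrite mxE mul0r.
(* The minimiser of [|d - s m|]. The point [y - s *: m] is then closer to [x] than [y], yet outside
   [A], since [y] lies between it and the point [y + m] of [A]. *)
pose s := edot m d / edot m m.
have s0 : 0 < s by rewrite divr_gt0.
have s1 : 0 < 1 + s by rewrite ltr_wpDl.
have nAz : ~ A (y - s *: m).
  move=> Az; apply: nAy.
  have -> : y = (1 - s / (1 + s)) *: (y - s *: m) + (s / (1 + s)) *: (x + l^-1 *: w).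
    have -> : x + l^-1 *: w = y + m by rewrite mP [RHS]addrC subrK.
    have -> : 1 - s / (1 + s) = (1 + s)^-1 by field; rewrite gt_eqF.
    rewrite scalerBr scalerDr scalerA addrACA -scalerDl [_ * s]mulrC addNr addr0.
    by rewrite -[X in X + _]mul1r -mulrDl divff ?scale1r// gt_eqF.
  apply: cA => //; rewrite divr_ge0 ?(ltW s0) ?(ltW s1)//=.
  by rewrite ler_pdivrMr// mul1r lerDr.
have := noball _ nAz.
rewrite (_ : y - s *: m - x = d - s *: m); last by rewrite /d addrAC.
have smm : s * edot m m = edot m d by rewrite divfK// gt_eqF.
have smd : 0 < s * edot m d by rewrite mulr_gt0.
rewrite edot_sqrBZ -/D -mulrA smm; lra.
Qed.

End nearest_point.

(** The sign of the inner product decides between [w] and [- w] in [edot_le_gauge]. The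
    normalisation of [nu] and the division by the distance together supply the squared length of
    [y - x]. *)
Lemma normal_le_gauge k (A : set (V k)) (x nu w : V k) :
  open A -> econvex A -> A x ->
  (exists y, [/\ bdry A y, enorm (x - y) = dist_bd A x &
     nu = (enorm (y - x))^-1 *: (y - x)]) ->
  `|edot w nu| / dist_bd A x <= Num.max (gauge A x w) (gauge A x (- w)).
Proof.
move=> oA cA Ax [y [yA xy ->]].
have nAy : ~ A y.
  by case: yA => _; rewrite (_ : interior A = A)//; exact/interior_id.
have D0 : 0 < edot (y - x) (y - x).
  rewrite lt_neqAle edot_ge0 andbT eq_sym edot_eq0 subr_eq0.
  by apply: contra_notN nAy => /eqP ->.
have dE : dist_bd A x = enorm (y - x) by rewrite -xy -opprB enormN.
have d0 : 0 < enorm (y - x) by rewrite sqrtr_gt0.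
have d2 : enorm (y - x) * enorm (y - x) = edot (y - x) (y - x).
  by rewrite -expr2 sqr_sqrtr// ltW.
rewrite edotZr normrM gtr0_norm ?invr_gt0// mulrAC -invfM -dE dE d2 mulrC.
rewrite ler_pdivrMr//; set g := Num.max _ _.
have H1 := edot_le_gauge oA cA w Ax yA xy.
have := edot_le_gauge oA cA (- w) Ax yA xy; rewrite edotNl => H2.
have g1 : gauge A x w <= g by rewrite le_max lexx.
have g2 : gauge A x (- w) <= g by rewrite le_max lexx orbT.
rewrite ler_norml; apply/andP; split; nra.
Qed.
End Geometry.

(** * Derivatives along flows *)

Section Flow.
Variable R : realType.
Notation V k := 'rV[R]_k.
Implicit Types (M a s t e C : R).

Lemma bounded_on_box k M (W : V k -> V k) : continuous W ->
  exists2 C : R, 0 <= C & forall v : V k, (forall j, `|v 0 j| <= M) ->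
    forall j, `|W v 0 j| <= C.
Proof.
move=> cW.
pose box : set (V k) := [set v | forall j, `[- M, M]%classic (v ord0 j)].
have cbox : compact box.
  by apply: (@rV_compact R k (fun=> `[- M, M]%classic)) => j; exact: segment_compact.
have /compact_bounded[C [_ HC]] : compact (W @` box).
  by apply: continuous_compact => //; exact: continuous_subspaceT.
exists (`|C| + 1); first by rewrite addr_ge0.
move=> v vM j; have /HC : C < `|C| + 1 by rewrite (le_lt_trans (ler_norm _))// ltrDl.
move=> /(_ (W v)) H; apply: le_trans (H _).
  by rewrite [leRHS]mx_normrE; apply/bigmax_geP; right; exists (0, j).
by exists v => // i; rewrite /= in_itv/= -ler_norml.
Qed.

(* The flow preserves [rint], so the difference quotients of [B] along [W], which
   converge uniformly to [DB], all have integral [0]. *)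
Lemma rint_flow_derive k M (W : V k -> V k) (B DB : V k -> R) :
  0 <= M -> continuous W ->
  (forall (v : V k) s, W (v + s *: W v) = W v) ->
  (forall (v w : V k) (j : 'I_k), (forall l : 'I_k, (l < j)%N -> v 0 l = w 0 l) ->
     W v 0 j = W w 0 j) ->
  continuous B -> continuous DB ->
  (forall (v : V k) j, M < `|v 0 j| -> B v = 0) ->
  (forall (v : V k) j, M < `|v 0 j| -> DB v = 0) ->
  (forall (v : V k) s, is_derive s 1 (fun r : R => B (v + r *: W v)) (DB (v + s *: W v))) ->
  rint DB = 0.
Proof.
move=> M0 cW Winv Wtri cB cDB B0 DB0 dB.
have [C C0 HC] := bounded_on_box M cW.
have ccB : cc M B by exact: continuous_cc.
have ccDB : cc M DB by exact: continuous_cc.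
(* A point that flows into the box within time 1 starts in the box of size [M + C]: [W] is the same
   at both ends of the path, so its bound at the endpoint holds at the start. *)
pose M' := M + C.
have MM' : M <= M' by rewrite lerDl.
have M'0 : 0 <= M' by exact: le_trans MM'.
have outer (v : V k) s : ~ (forall j, `|(v + s *: W v) 0 j| <= M) ->
    B (v + s *: W v) = 0 /\ DB (v + s *: W v) = 0.
  by move=> /existsNP[j /negP]; rewrite -ltNge => Mj; split; [exact: B0 Mj|exact: DB0 Mj].
have inner (v : V k) s : (forall j, `|(v + s *: W v) 0 j| <= M) -> forall j, `|W v 0 j| <= C.
  by move=> /HC H j; have := H j; rewrite Winv.
have ccBf s : 0 < s <= 1 -> cc M' (fun v => B (v + s *: W v)).
  move=> /andP[s0 s1]; apply: continuous_cc => [v|v j M'v].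
    apply: (@continuous_comp (V k) (V k) R (fun v => v + s *: W v) B); last exact: cB.
    by apply: (@continuousDZ R (V k) (V k) id W) => //; exact: cW.
  apply: (outer _ _ _).1 => vM; have := inner _ _ vM j; have := vM j.
  rewrite !mxE => vj Wj; move: M'v; rewrite ltNge => /negP; apply.
  have := ler_normB (v 0 j + s * W v 0 j) (s * W v 0 j); rewrite addrK.
  have : `|s * W v 0 j| <= C by rewrite normrM gtr0_norm// (le_trans _ Wj)// ler_piMl.
  rewrite /M'; lra.
apply/eqP; rewrite -normr_le0; apply/ler_addgt0Pr => e e0; rewrite add0r.
pose P := (2 * M') ^+ k + 1.
have P0 : 0 < P by rewrite ltr_wpDl// exprn_ge0// mulr_ge0.
have [d d0 Hd] := ccDB.1 _ (divr_gt0 e0 P0).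
(* [s <= 1] keeps supports inside [M'], and [s * C < d] makes [DB] vary by less than [e / P] along
   the path. *)
pose s := Num.min 1 (d / (C + 1)).
have C10 : 0 < C + 1 by rewrite ltr_wpDl.
have s0 : 0 < s by rewrite lt_min ltr01 divr_gt0.
have s1 : s <= 1 by rewrite ge_min lexx.
have sd : s * C < d.
  have : s <= d / (C + 1) by rewrite ge_min lexx orbT.
  rewrite ler_pdivlMr//; apply: lt_le_trans.
  by rewrite ltr_pM2l// ltrDl.
(* The first-order remainder along the flow: its integral is [- (s * rint DB)] because the shear
   preserves [rint B], and the mean value theorem bounds it by [s * (e / P)]. *)
pose H (v : V k) := B (v + s *: W v) + (-1) * (B v + s * DB v).
have ccBD : cc M (fun v => B v + s * DB v) by apply: ccD => //; exact: ccZ.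
have ccH : cc M' H.
  apply: ccD; first by apply: ccBf; rewrite s0.
  by apply: ccZ; exact: cc_le ccBD.
have HE : rint H = - (s * rint DB).
  rewrite (rintD M'0 (ccBf s _))//; last 2 first.
    by rewrite s0.
    by apply: ccZ; exact: cc_le ccBD.
  rewrite (rintZ _ M0 ccBD) (rintD M0)//; last exact: ccZ.
  rewrite (rintZ _ M0 ccDB) (@rint_shear _ _ M (fun v => s *: W v))//; first by ring.
  by move=> v w j vw; rewrite !mxE (Wtri _ _ _ vw).
have Hb v : `|H v| <= s * (e / P).
  have cBv : {within `[0, s], continuous (fun r : R => B (v + r *: W v))}.
    apply: continuous_subspaceT => r.
    apply: (@continuous_comp R (V k) R (fun r : R => v + r *: W v) B); last exact: cB.
    apply: (@cvgD _ (V k)); first exact: cvg_cst.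
    by apply: (@cvgZr_tmp _ (V k)); exact: cvg_id.
  have [c c0s BE] := MVT s0 (fun r _ => dB v r) cBv.
  move: c0s; rewrite in_itv/= => /andP[c0 cs].
  rewrite scale0r addr0 subr0 in BE.
  have -> : H v = s * (DB (v + c *: W v) - DB v).
    rewrite /H (_ : B (v + s *: W v) = B v + DB (v + c *: W v) * s); first by ring.
    by rewrite -BE [RHS]addrC subrK.
  rewrite normrM gtr0_norm// ler_pM2l//.
  have near_ : (forall j, `|W v 0 j| <= C) -> `|DB (v + c *: W v) - DB v| <= e / P.
    move=> WC; apply/ltW/Hd => j; rewrite !mxE addrAC subrr add0r normrM gtr0_norm//.
    by apply: le_lt_trans sd; rewrite ler_pM// ltW.
  (* If either endpoint is in the box, the speed is at most [C]; otherwise both values of [DB] are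
     0. *)
  have [/inner/near_//|/outer[_ D1]] := pselect (forall j, `|(v + c *: W v) 0 j| <= M).
  have [|/outer[_ D2]] := pselect (forall j, `|(v + 0 *: W v) 0 j| <= M).
    by move/inner/near_.
  rewrite scale0r addr0 in D2.
  by rewrite D1 D2 subrr normr0 divr_ge0// ltW.
have := rint_le_norm M'0 ccH Hb; rewrite HE normrN normrM gtr0_norm// mulrCA.
rewrite ler_pM2l// => /le_trans; apply.
rewrite mulrCA ler_piMr ?(ltW e0)// ler_pdivrMr// mul1r lerDl//.
Qed.

End Flow.

(** * Powers of absolute values and gauges: continuity and derivatives *)

Section Calculus.
Variable R : realType.
Notation V k := 'rV[R]_k.
Implicit Types (p q r s t e : R).

Lemma continuous_normr_powR r : 0 < r -> continuous (fun t : R => `|t| `^ r).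
Proof.
move=> r0 t; have [->|t0] := eqVneq t 0.
  apply/cvgrPdist_le => e e0; rewrite normr0 powR0 ?gt_eqF//; near=> h.
  (* With [e] written as the [r]-th power of [e^(1/r)], it suffices to compare bases. *)
  rewrite sub0r normrN ger0_norm ?powR_ge0// -[leRHS](powRr1 (ltW e0)).
  rewrite -(@mulVf _ r) ?gt_eqF// powRrM.
  apply: ge0_ler_powR; rewrite ?nnegrE ?powR_ge0 ?(ltW r0)//.
  rewrite -[`|h|]normrN -[- h]add0r.
  near: h; apply: cvgr_dist_le; first exact: cvg_id.
  by rewrite powR_gt0.
apply: (@continuous_comp _ _ _ (@Num.norm _ R) (fun x => x `^ r)).
  exact: norm_continuous.
apply: differentiable_continuous; apply/derivable1_diffP.
by apply: derivable_powR; rewrite in_itv/= andbT normr_gt0.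
Unshelve. all: by end_near. Qed.

Lemma continuous_normr_powRM r : 0 <= r -> continuous (fun t : R => `|t| `^ r * t).
Proof.
move=> r0 t; suff ct : {for t, continuous (fun t : R => `|t| `^ r)}.
  by apply: cvgM; [exact: ct|exact: cvg_id].
move: r0; rewrite le_eqVlt => /predU1P[<-|r0]; last exact: continuous_normr_powR.
(* Since [0 ^ 0 = 1] here, the factor is constant even at 0; this is the case [p = 2] of later
   uses. *)
rewrite (_ : (fun _ => _) = cst 1); first exact: cst_continuous.
by apply/funext => x; rewrite powRr0.
Qed.

Lemma is_derive_normr_powR p t : 2 <= p ->
  is_derive t 1 (fun x : R => `|x| `^ p) (p * (`|t| `^ (p - 2) * t)).
Proof.
move=> p2; have p0 : 0 < p by lra.
have pE x : 0 < x -> x `^ (p - 1) = x `^ (p - 2) * x.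
  move=> x0; rewrite (_ : p - 1 = p - 2 + 1); last by ring.
  by rewrite powRD ?powRr1 ?(ltW x0)// (gt_eqF x0) implybT.
have [t0|t0|->] := ltgtP t 0.
- have d1 : is_derive (- t) 1 (@powR R ^~ p) (p * (- t) `^ (p - 1)).
    by apply: is_derive1_powR; rewrite oppr_gt0.
  have d2 : is_derive t 1 (-%R : R -> R) (-1).
    by apply: is_deriveNid.
  have := @is_derive1_comp _ (@powR R ^~ p) -%R _ _ _ d1 d2.
  rewrite pE ?oppr_gt0// ltr0_norm// mulrN1 !mulrN opprK.
  apply: near_eq_is_derive; near=> y.
  rewrite /= ltr0_norm//; near: y; exact: lt_nbhsl.
- have := @is_derive1_powR _ p t t0.
  rewrite pE// gtr0_norm//.
  apply: near_eq_is_derive; near=> y.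
  rewrite /= gtr0_norm//; near: y; exact: lt_nbhsr.
(* At 0 the difference quotient has absolute value [|h|^(p-1)], which tends to 0. *)
- rewrite mulr0 mulr0.
  suff H : (fun h : R => h^-1 *: (`|h *: (1 : R) + 0| `^ p - `|0 : R| `^ p)) @
      (0 : R)^' --> (0 : R).
    by split; [exact: cvgP H|exact: cvg_lim H].
  apply/cvgrPdist_le => e e0; near=> h.
  have h0 : h != 0 by near: h; exact: nbhs_dnbhs_neq.
  rewrite normr0 powR0 ?gt_eqF// subr0 addr0 sub0r normrN normrZ normrV ?unitfE//.
  rewrite /GRing.scale/= mulr1 (ger0_norm (powR_ge0 _ _)).
  rewrite -(@mulr_powRB1 _ `|h| p)// mulKf ?normr_eq0//.
  near: h; apply: nbhs_dnbhs.
  have p10 : 0 < p - 1 by lra.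
  have := @continuous_normr_powR (p - 1) p10 0.
  move/cvgrPdist_le => /(_ e e0); rewrite normr0 powR0 ?gt_eqF//.
  by apply: filterS => h; rewrite sub0r normrN ger0_norm ?powR_ge0.
Unshelve. all: by end_near. Qed.

Section gauge_powR.
Variables (k : nat) (A : set (V k)) (p : R).
Hypotheses (oA : open A) (cA : econvex A) (p1 : 1 < p).
Implicit Types x w : V k.

(** By [gauge_shift], near [s] the gauge at parameter [r] is [g / h r] with [h] affine and
    [h s = 1], so its power is differentiated explicitly, also when [g = 0]. *)
Lemma is_derive_gauge_powR x w s : A (x + s *: w) ->
  is_derive s 1 (fun r : R => gauge A (x + r *: w) w `^ (p - 1))
    ((p - 1) * gauge A (x + s *: w) w `^ p).
Proof.
move=> As; set g := gauge A (x + s *: w) w.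
have g0 : 0 <= g by exact: gauge_ge0.
pose h (r : R) := 1 + s * g - r * g.
have hs : h s = 1 by rewrite /h; ring.
have dh : is_derive s 1 h (- g).
  have := is_deriveB (is_derive_cst (1 + s * g) s 1) (is_deriveZ g (is_derive_id s 1)).
  rewrite sub0r /GRing.scale/= mulr1; congr (is_derive _ _ _ _).
  by apply/funext => r; rewrite /h [r * g]mulrC.
have d1 : is_derive (h s) 1 (@powR R ^~ (- (p - 1))) (- (p - 1)).
  rewrite hs; have := @is_derive1_powR R (- (p - 1)) 1 ltr01.
  by rewrite powR1 mulr1.
have d2 := @is_derive1_comp _ (@powR R ^~ (- (p - 1))) h _ _ _ d1 dh.
have d3 := is_deriveZ (g `^ (p - 1)) d2.
have -> : (p - 1) * g `^ p = g `^ (p - 1) *: (- (p - 1) * - g).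
  rewrite /GRing.scale/= mulrNN -(@mulr_powRB1 _ g p g0) ?(lt_trans ltr01)//.
  by ring.
move: d3; apply: near_eq_is_derive.
have ch : {for s, continuous h}.
  apply: differentiable_continuous; apply/derivable1_diffP.
  exact: (@ex_derive _ _ _ _ _ _ _ dh).
have nA : \forall r \near s, A (x + r *: w).
  apply: (@near_open R (V k) A (fun r => x + r *: w) s oA) => //.
  apply: (@cvgD _ (V k)); first exact: cvg_cst.
  by apply: (@cvgZr_tmp _ (V k)); exact: cvg_id.
have nh : \forall r \near s, 0 < h r.
  by apply: (ch [set y | 0 < y]); apply: lt_nbhsr; rewrite hs.
near=> r; have hr : 0 < h r by near: r.
have Ar : A (x + r *: w) by near: r.
have := @gauge_shift _ _ _ oA cA (x + s *: w) w (r - s) As.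
rewrite -addrA -scalerDl [s + _]addrC subrK => /(_ Ar); rewrite -/g.
have -> : 1 - (r - s) * g = h r by rewrite /h; ring.
move=> <-; rewrite /= /GRing.scale/= powRM ?gauge_ge0 ?(ltW hr)//.
by rewrite powRN mulfK// gt_eqF// powR_gt0.
Unshelve. all: by end_near. Qed.

End gauge_powR.

Lemma is_derive_line k (u : V k -> R) (x w : V k) s :
  differentiable u (x + s *: w) ->
  is_derive s 1 (fun r : R => u (x + r *: w)) ('D_w u (x + s *: w)).
Proof.
move=> du; have E : (fun h : R => h^-1 *:
    (((fun r : R => u (x + r *: w)) \o shift s) (h *: 1) - u (x + s *: w))) =
  (fun h : R => h^-1 *: ((u \o shift (x + s *: w)) (h *: w) - u (x + s *: w))).
  apply/funext => h /=; congr (_ *: (u _ - _)).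
  have -> : h *: (1 : R^o) = h by exact: mulr1.
  by rewrite scalerDl addrCA.
by apply: DeriveDef; rewrite /derivable /derive E //; exact: diff_derivable.
Qed.
End Calculus.

(** * The Hardy inequality along one vector field *)

Section Inequalities.
Variable R : realType.
Implicit Types (p q x y : R).

Lemma powR_div p x y : 0 <= x -> 0 <= y -> (x / y) `^ p = x `^ p / y `^ p.
Proof.
move=> x0 y0; rewrite powRM ?invr_ge0//; congr (_ * _).
by rewrite -(powR_inv1 y0) powRAC powR_inv1 ?powR_ge0.
Qed.

Lemma normr_powRM p x : 2 <= p -> `| `|x| `^ (p - 2) * x| = `|x| `^ (p - 1).
Proof.
move=> p2; rewrite normrM (ger0_norm (powR_ge0 _ _)).
have [->|x0] := eqVneq x 0.
  by rewrite normr0 mulr0 powR0// gt_eqF//; lra.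
rewrite (_ : p - 1 = p - 2 + 1); last by ring.
by rewrite (@powRD _ _ (p - 2) 1) ?normr_eq0 ?x0 ?implybT// powRr1.
Qed.

(** Young's inequality for [x] and [y^(p-1)] with exponents [p] and [p / (p-1)], multiplied by
    [p]. *)
Lemma young_powR p x y : 1 < p -> 0 <= x -> 0 <= y ->
  p * (x * y `^ (p - 1)) <= x `^ p + (p - 1) * y `^ p.
Proof.
move=> p1 x0 y0; have p0 : 0 < p by lra.
have p10 : 0 < p - 1 by lra.
have q0 : 0 < p / (p - 1) by rewrite divr_gt0.
have pq : p^-1 + (p / (p - 1))^-1 = 1 by field; rewrite !gt_eqF.
have := conjugate_powR x0 (powR_ge0 y (p - 1)) p0 q0 pq.
rewrite -powRrM (_ : (p - 1) * (p / (p - 1)) = p); last by field; rewrite gt_eqF.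
rewrite -(ler_pM2l p0) => /le_trans; apply.
rewrite le_eqVlt; apply/orP; left; apply/eqP; field.
by rewrite !gt_eqF.
Qed.

(* With [f = u], [a = W u], [al] and [be] the gauges in the directions [W] and
   [-W], the last factor is the sum of the derivatives of [|u|^p al^(p-1)] along
   [W] and of [|u|^p be^(p-1)] along [-W]. *)
Lemma hardy_pointwise p (a f al be : R) : 2 <= p -> 0 <= al -> 0 <= be ->
  ((p - 1) / p) `^ p * (Num.max al be `^ p * `|f| `^ p) <=
  `|a| `^ p + ((p - 1) / p) `^ (p - 1) *
    ((p * (`|f| `^ (p - 2) * f) * a * al `^ (p - 1) +
      `|f| `^ p * ((p - 1) * al `^ p)) +
     (p * (`|f| `^ (p - 2) * f) * - a * be `^ (p - 1) +
      `|f| `^ p * ((p - 1) * be `^ p))).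
Proof.
move=> p2 al0 be0; set q := (p - 1) / p; set m := Num.max al be.
have p0 : 0 < p by lra.
have p1 : 1 < p by lra.
have q0 : 0 < q by rewrite divr_gt0//; lra.
have m0 : 0 <= m by rewrite le_max al0.
move: (normr_powRM f p2); move: (`|f| `^ (p - 2) * f) => g gE.
have ge0 (x r : R) : 0 <= x `^ r by exact: powR_ge0.
have mono r x y : 0 <= r -> 0 <= x -> x <= y -> x `^ r <= y `^ r.
  by move=> r0 x0 xy; apply: ge0_ler_powR; rewrite ?nnegrE// (le_trans x0).
have p10 : 0 <= p - 1 by lra.
have am : al <= m by rewrite le_max lexx.
have bm : be <= m by rewrite le_max lexx orbT.
have a1 := mono _ _ _ p10 al0 am.
have b1 := mono _ _ _ p10 be0 bm.
have mab : m `^ p <= al `^ p + be `^ p.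
  rewrite /m; case: (leP al be) => _; [rewrite lerDr|rewrite lerDl]; exact: ge0.
have qp : q `^ p = q * q `^ (p - 1) by rewrite mulr_powRB1// ltW.
(* This equation is the source of the constant: the gain [p - 1] less the loss [(p - 1) * q] from
   Young's inequality leaves exactly [q]. *)
have qq : (p - 1) * (1 - q) = q by rewrite /q; field; rewrite gt_eqF.
clearbody q m.
(* Young's inequality for [|a|] and [q * m * |f|], chosen so that its mixed term is the one in
   [T]. *)
have := young_powR p1 (normr_ge0 a) (mulr_ge0 (mulr_ge0 (ltW q0) m0) (normr_ge0 f)).
rewrite !powRM ?mulr_ge0 ?(ltW q0)//.
(* The mixed terms carry [a] and [- a], so only the difference of [al^(p-1)] and [be^(p-1)] remains,
   at most [m^(p-1)] in absolute value. *)
have T : - (p * (`|a| * (q `^ (p - 1) * m `^ (p - 1) * `|f| `^ (p - 1)))) <=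
    q `^ (p - 1) * (p * g * a * (al `^ (p - 1) - be `^ (p - 1))).
  have ab : `|al `^ (p - 1) - be `^ (p - 1)| <= m `^ (p - 1).
    have := ge0 al (p - 1); have := ge0 be (p - 1).
    by rewrite ler_norml => ? ?; apply/andP; split; lra.
  rewrite lerNl; apply: le_trans (ler_norm _) _.
  rewrite normrN !normrM gE (ger0_norm (ge0 _ _)) (gtr0_norm p0).
  rewrite (_ : p * (`|a| * _) =
     q `^ (p - 1) * (p * `|f| `^ (p - 1) * `|a| * m `^ (p - 1))); last by ring.
  by rewrite ler_wpM2l// ler_wpM2l// !mulr_ge0// ltW.
have S : q `^ (p - 1) * ((p - 1) * `|f| `^ p * m `^ p) <=
    q `^ (p - 1) * ((p - 1) * `|f| `^ p * (al `^ p + be `^ p)).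
  by rewrite ler_wpM2l// ler_wpM2l// mulr_ge0.
have E : q `^ p * (m `^ p * `|f| `^ p) =
    q `^ (p - 1) * ((p - 1) * `|f| `^ p * m `^ p) -
    (p - 1) * (q `^ p * m `^ p * `|f| `^ p).
  by rewrite qp -{1}qq; ring.
lra.
Qed.

(** Each square is at most the total [S], so [|x|^p = |x|^(p-2) x^2] is at most [S^((p-2)/2) x^2],
    the exponent [p - 2] being nonnegative; then sum. *)
Lemma sum_powR_le (I : finType) p (a b : I -> R) : 2 <= p ->
  \sum_i (`|a i| `^ p + `|b i| `^ p) <=
  Num.sqrt (\sum_i (a i ^+ 2 + b i ^+ 2)) `^ p.
Proof.
move=> p2; set S := \sum_i (a i ^+ 2 + b i ^+ 2); have S0 : 0 <= S.
  by apply: sumr_ge0 => i _; rewrite addr_ge0 ?sqr_ge0.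
have split_p x : 0 <= x -> x `^ p = x `^ (p - 2) * x ^+ 2.
  move=> x0; rewrite -(powR_mulrn 2 x0) -powRD ?subrK//.
  by rewrite gt_eqF//; lra.
have H x : x ^+ 2 <= S -> `|x| `^ p <= Num.sqrt S `^ (p - 2) * x ^+ 2.
  move=> xS; rewrite split_p// real_normK ?num_real//.
  apply: ler_wpM2r; first exact: sqr_ge0.
  apply: ge0_ler_powR; rewrite ?nnegrE ?sqrtr_ge0 ?subr_ge0//.
  by rewrite -sqrtr_sqr ler_wsqrtr.
rewrite [leRHS]split_p ?sqrtr_ge0// sqr_sqrtr//.
apply: (@le_trans _ _ (\sum_i Num.sqrt S `^ (p - 2) * (a i ^+ 2 + b i ^+ 2))).
  apply: ler_sum => i _.
  have Si : a i ^+ 2 + b i ^+ 2 <= S.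
    have -> : S = a i ^+ 2 + b i ^+ 2 + \sum_(j | j != i) (a j ^+ 2 + b j ^+ 2).
      by rewrite /S (bigD1 i).
    rewrite lerDl; apply: sumr_ge0 => j _.
    by rewrite addr_ge0 ?sqr_ge0.
  have sa := sqr_ge0 (a i); have sb := sqr_ge0 (b i).
  by rewrite mulrDr lerD// H//; lra.
by rewrite -mulr_sumr.
Qed.

End Inequalities.

Section HardyField.
Variable R : realType.
Notation V k := 'rV[R]_k.
Implicit Types (M p r s t : R).

(* Both [X_i] and [Y_i] have these properties: the orbits of [W] are straight
   lines, and its flow is a triangular shear. *)
Definition shear_field k (W : V k -> V k) :=
  [/\ continuous W, (forall (v : V k) s, W (v + s *: W v) = W v) &
      (forall (v w : V k) (j : 'I_k),
         (forall l : 'I_k, (l < j)%N -> v 0 l = w 0 l) -> W v 0 j = W w 0 j)].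

Lemma continuous_opp (S : topologicalType) (W : normedModType R) (f : S -> W) :
  continuous f -> continuous (fun z => - f z).
Proof. by move=> cf z; apply: cvgN; exact: cf. Qed.

Lemma continuous_addZ (S : topologicalType) (W : normedModType R) (f : S -> R)
    (a b : W) : continuous f -> continuous (fun z => a + f z *: b).
Proof. by move=> cf z; apply: cvgD; [exact: cvg_cst|apply: cvgZr_tmp; exact: cf]. Qed.

Lemma continuous_mul (S : topologicalType) (f g : S -> R) x :
  {for x, continuous f} -> {for x, continuous g} ->
  {for x, continuous (fun z => f z * g z)}.
Proof. exact: cvgM. Qed.

Lemma continuous_add (S : topologicalType) (f g : S -> R) x :
  {for x, continuous f} -> {for x, continuous g} ->
  {for x, continuous (fun z => f z + g z)}.
Proof. exact: cvgD. Qed.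

Lemma shear_fieldN k (W : V k -> V k) :
  shear_field W -> shear_field (fun v => - W v).
Proof.
move=> [cW iW tW]; split.
- exact: (@continuous_opp (V k) (V k)).
- by move=> v s; rewrite scalerN -scaleNr iW.
- by move=> v w j /tW vw; rewrite !mxE vw.
Qed.

Lemma continuous_eq_on_open (S : topologicalType) (A : set S) (f g : S -> R) x :
  open A -> A x -> (forall z, A z -> f z = g z) ->
  {for x, continuous f} -> {for x, continuous g}.
Proof.
move=> oA Ax fg cf; have nA : nbhs x A by exact: open_nbhs_nbhs.
rewrite /prop_for /continuous_at -(fg x Ax).
by apply: cvg_trans cf; apply: near_eq_cvg; apply: filterS nA => z /fg.
Qed.

(** A point outside [A] has a neighbourhood missing [K], so continuity is checked only on [A], where
    the gauge is under control. *)
Lemma continuous_supported (S : topologicalType) (A K : set S) (f : S -> R) :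
  closed K -> K `<=` A -> (forall x, ~ K x -> f x = 0) ->
  (forall x, A x -> {for x, continuous f}) -> continuous f.
Proof.
move=> cK KA f0 cf x; have [/cf//|nA] := pselect (A x).
have nK : ~ K x by move/KA.
have nf : \forall z \near x, 0 = f z.
  have : nbhs x (~` K) by apply: open_nbhs_nbhs; split => //; exact: closed_openC.
  by apply: filterS => z nKz; rewrite f0.
rewrite /continuous_at f0//.
by apply: cvg_trans (near_eq_cvg nf) _; exact: cvg_cst.
Qed.

Definition hardy_flux k (A : set (V k)) p (u : V k -> R) (W : V k -> V k) v : R :=
  `|u v| `^ p * gauge A v (W v) `^ (p - 1).

(* The derivative of [hardy_flux] along [W], where [Du] stands for [W u]; its
   second term comes from [W (gauge^(p-1)) = (p-1) gauge^p]. *)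
Definition hardy_div k (A : set (V k)) p (u Du : V k -> R) (W : V k -> V k) v : R :=
  p * (`|u v| `^ (p - 2) * u v) * Du v * gauge A v (W v) `^ (p - 1) +
  `|u v| `^ p * ((p - 1) * gauge A v (W v) `^ p).

Section field.
Variables (k : nat) (A K : set (V k)) (M p : R) (u : V k -> R).
Hypotheses (oA : open A) (cA : econvex A) (clK : closed K) (KA : K `<=` A).
Hypotheses (M0 : 0 <= M) (KM : forall (v : V k) j, M < `|v 0 j| -> ~ K v).
Hypotheses (p2 : 2 <= p) (du : forall v, differentiable u v).
Hypotheses (u0 : forall v, ~ K v -> u v = 0).

Let p0 : p != 0. Proof. by rewrite gt_eqF//; have := p2; lra. Qed.
Let p_gt0 : 0 < p. Proof. by have := p2; lra. Qed.
Let p10 : 0 < p - 1. Proof. by have := p2; lra. Qed.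

Let flux0 W v : ~ K v -> hardy_flux A p u W v = 0.
Proof. by move=> /u0 uv; rewrite /hardy_flux uv normr0 powR0// mul0r. Qed.

Let div0 Du W v : ~ K v -> hardy_div A p u Du W v = 0.
Proof.
by move=> /u0 uv; rewrite /hardy_div uv normr0 (powR0 p0) !(mul0r, mulr0) addr0.
Qed.

Let cu : continuous u.
Proof. by move=> v; exact: differentiable_continuous. Qed.

Let cgauge W v : shear_field W -> A v ->
  {for v, continuous (fun z => gauge A z (W z))}.
Proof. by move=> [cW _ _] Av; apply: gauge_continuous => //; exact: cW. Qed.

Let cgauge_powR W v r : shear_field W -> A v -> 0 < r ->
  {for v, continuous (fun z => gauge A z (W z) `^ r)}.
Proof.
move=> sW Av r0.
(* The gauge may vanish, and powers of absolute values are continuous at 0 too; on [A] the gauge is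
   nonnegative. *)
have H : {for v, continuous (fun z => `|gauge A z (W z)| `^ r)}.
  apply: (@continuous_comp (V k) R R (fun z => gauge A z (W z)) (fun t => `|t| `^ r)).
    exact: cgauge.
  exact: continuous_normr_powR.
apply: (@continuous_eq_on_open (V k) A _ _ v oA Av _ H) => z Az.
by rewrite ger0_norm ?gauge_ge0.
Qed.

Let cu_powR : continuous (fun v => `|u v| `^ p).
Proof.
move=> v; apply: (@continuous_comp (V k) R R u (fun t => `|t| `^ p)); first exact: cu.
exact: continuous_normr_powR.
Qed.

Let cu_powRM : continuous (fun v => `|u v| `^ (p - 2) * u v).
Proof.
move=> v; apply: (@continuous_comp (V k) R R u (fun t => `|t| `^ (p - 2) * t)).
  exact: cu.
by apply: continuous_normr_powRM; rewrite subr_ge0.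
Qed.

Let cflux W : shear_field W -> continuous (hardy_flux A p u W).
Proof.
move=> sW; apply: (@continuous_supported (V k) A K) => // [v|v Av]; first exact: flux0.
apply: (@continuous_mul (V k)); first exact: cu_powR.
exact: cgauge_powR.
Qed.

Let cdiv Du W : continuous Du -> shear_field W ->
  continuous (hardy_div A p u Du W).
Proof.
move=> cDu sW; apply: (@continuous_supported (V k) A K) => // [v|v Av]; first exact: div0.
apply: (@continuous_add (V k)).
  apply: (@continuous_mul (V k)); last exact: cgauge_powR.
  apply: (@continuous_mul (V k)); last exact: cDu.
  apply: (@continuous_mul (V k)); last exact: cu_powRM.
  exact: cst_continuous.
apply: (@continuous_mul (V k)); first exact: cu_powR.
apply: (@continuous_mul (V k)); first exact: cst_continuous.
exact: cgauge_powR.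
Qed.

Let is_derive_flux Du W v s : shear_field W ->
  (forall v, 'D_(W v) u v = Du v) ->
  is_derive s 1 (fun r : R => hardy_flux A p u W (v + r *: W v))
    (hardy_div A p u Du W (v + s *: W v)).
Proof.
move=> [cW iW _] hDu; have [As|nAs] := pselect (A (v + s *: W v)).
  have d1 := is_derive_line (du (v + s *: W v)).
  have d2 := @is_derive1_comp R (fun x => `|x| `^ p) (fun r => u (v + r *: W v)) s _ _
    (is_derive_normr_powR _ p2) d1.
  have p1 : 1 < p by have := p2; lra.
  have d3 := is_derive_gauge_powR oA cA p1 As.
  have d4 := is_deriveM d2 d3.
  (* [W] is constant along the line, so the gauge is taken in one fixed direction, as in [d3]. *)
  rewrite /hardy_div iW -hDu iW.
  rewrite (_ : (fun r => _) = ((fun x => `|x| `^ p) \o (fun r => u (v + r *: W v))) *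
    (fun r => gauge A (v + r *: W v) (W v) `^ (p - 1))); last first.
    by apply/funext => r; rewrite /hardy_flux iW.
  move: d4; congr (is_derive _ _ _ _).
  by rewrite /GRing.scale/= addrC mulrC.
(* Outside [A] the line stays off [K] for nearby parameters, where the flux is identically 0. *)
have nKs : ~ K (v + s *: W v) by move/KA.
rewrite div0//.
have nf : \forall r \near s, cst 0 r = hardy_flux A p u W (v + r *: W v).
  have cl : {for s, continuous (fun r : R => v + r *: W v)}.
    have ci : continuous (fun r : R => r) by move=> r; exact: cvg_id.
    exact: (@continuous_addZ R (V k) _ v (W v) ci s).
  have := @near_open R (V k) (~` K) (fun r => v + r *: W v) s (closed_openC clK) cl nKs.
  by apply: filterS => r nK; rewrite flux0.
by apply: (near_eq_is_derive nf); exact: is_derive_cst.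
Qed.

Lemma hardy_div_cc Du W : continuous Du -> shear_field W ->
  cc M (hardy_div A p u Du W).
Proof.
move=> cDu sW; apply: continuous_cc; first exact: cdiv.
by move=> v j /KM; exact: div0.
Qed.

Lemma rint_hardy_div Du W : continuous Du -> shear_field W ->
  (forall v, 'D_(W v) u v = Du v) -> rint (hardy_div A p u Du W) = 0.
Proof.
move=> cDu sW hDu; have [cW iW tW] := sW.
apply: (rint_flow_derive M0 cW iW tW (cflux sW) (cdiv cDu sW)).
- by move=> v j /KM; exact: flux0.
- by move=> v j /KM; exact: div0.
- by move=> v s; exact: is_derive_flux.
Qed.

Lemma derive_supported v w : ~ K v -> 'D_w u v = 0.
Proof.
move=> nK; rewrite (@near_eq_derive _ _ _ _ (cst 0)); first exact: derive_cst.
have : nbhs v (~` K) by apply: open_nbhs_nbhs; split => //; exact: closed_openC.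
have /= := @filterS _ (nbhs v) _ (~` K) (fun z => u z = cst 0 z).
by apply=> // z /u0.
Qed.

(** A continuous majorant of the Hardy integrand of one field ([hardy_density_ge]) with the same
    integral as [|Du|^p] ([rint_hardy_density]). *)
Definition hardy_density Du W v : R :=
  `|Du v| `^ p + ((p - 1) / p) `^ (p - 1) *
    (hardy_div A p u Du W v +
     hardy_div A p u (fun z => - Du z) (fun z => - W z) v).

Lemma hardy_density_ge Du W v :
  ((p - 1) / p) `^ p *
    (Num.max (gauge A v (W v)) (gauge A v (- W v)) `^ p * `|u v| `^ p) <=
  hardy_density Du W v.
Proof.
have [Av|nA] := pselect (A v).
  by apply: hardy_pointwise => //; exact: gauge_ge0.
rewrite u0; last by move/KA.
rewrite normr0 powR0// !mulr0 /hardy_density !div0; try by move/KA.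
by rewrite addr0 mulr0 addr0 powR_ge0.
Qed.

Lemma rint_hardy_density Du W : continuous Du -> shear_field W ->
  (forall v, 'D_(W v) u v = Du v) ->
  [/\ cc M (fun v => `|Du v| `^ p), cc M (hardy_density Du W) &
      rint (hardy_density Du W) = rint (fun v => `|Du v| `^ p)].
Proof.
move=> cDu sW hDu.
have cN : continuous (fun z => - Du z).
  exact: (@continuous_opp (V k) R^o Du cDu).
have sN := shear_fieldN sW.
have hN v : 'D_(- W v) u v = - Du v.
  by rewrite -hDu !deriveE// linearN.
have cDp : cc M (fun v => `|Du v| `^ p).
  apply: continuous_cc => v.
    apply: (@continuous_comp (V k) R R Du (fun t => `|t| `^ p)); first exact: cDu.
    exact: continuous_normr_powR.
  by move=> j /KM nK; rewrite -hDu derive_supported// normr0 powR0.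
have c1 := hardy_div_cc cDu sW; have c2 := hardy_div_cc cN sN.
have c4 := ccZ (((p - 1) / p) `^ (p - 1)) (ccD c1 c2).
split => //; first exact: ccD cDp c4.
have z : rint (fun v => hardy_div A p u Du W v +
    hardy_div A p u (fun z => - Du z) (fun z => - W z) v) = 0.
  apply: etrans (rintD M0 c1 c2) (etrans (congr2 +%R _ _) (addr0 0)).
    exact: rint_hardy_div.
  exact: rint_hardy_div.
apply: etrans (rintD M0 cDp c4) (etrans (congr1 (+%R _) _) (addr0 _)).
exact: etrans (rintZ _ M0 (ccD c1 c2)) (etrans (congr1 _ z) (mulr0 _)).
Qed.

End field.
End HardyField.

(** * The Heisenberg vector fields *)

Section Heisenberg.
Variable R : realType.
Notation V k := 'rV[R]_k.

Lemma ixE n (i : 'I_n) : ix i = i :> nat.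
Proof. by rewrite inordK// /N ltnS (leq_trans (ltnW (ltn_ord i)))// leq_addr. Qed.

Lemma iyE n (i : 'I_n) : iy i = (n + i)%N :> nat.
Proof. by rewrite inordK// /N ltnS leq_add2l ltnW. Qed.

Lemma itE n : it n = (n + n)%N :> nat.
Proof. by rewrite inordK. Qed.

(** The field has entry 0 at [c], so its coefficient is constant along each line; [c < b] makes the
    shear triangular. For the Heisenberg fields [b] is the last coordinate [t]. *)
Lemma shear_field_line k (a b c : 'I_k) (r : R) : (c < b)%N -> c != a ->
  shear_field (fun v : V k => evec R a + (r * v 0 c) *: evec R b).
Proof.
move=> cb ca; have cb' : c != b by rewrite neq_ltn cb.
have W0 v : (evec R a + (r * v 0 c) *: evec R b) 0 c = 0.
  by rewrite !mxE (negbTE ca) (negbTE cb') mulr0 addr0.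
split.
- apply: (@continuous_addZ R (V k) (V k)) => v.
  apply: (@continuous_mul R (V k)); first exact: cst_continuous.
  exact: coord_continuous.
- move=> v s; congr (_ + _ *: _); congr (_ * _).
  by rewrite mxE [in X in _ + X]mxE W0 mulr0 addr0.
- move=> v w j vw; rewrite !mxE; case: (eqVneq j b) => [jb|_].
    by rewrite vw// jb.
  by rewrite !mulr0.
Qed.

Lemma shear_field_Xvec n (i : 'I_n) : shear_field (Xvec i : V (N n) -> V (N n)).
Proof.
apply: shear_field_line; first by rewrite iyE itE ltn_add2l.
by rewrite -val_eqE /= ixE iyE gtn_eqF// ltn_addr.
Qed.

Lemma shear_field_Yvec n (i : 'I_n) : shear_field (Yvec i : V (N n) -> V (N n)).
Proof.
rewrite (_ : Yvec i = fun v => evec R (iy i) + (- 2 * v 0 (ix i)) *: evec R (it n)).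
  apply: shear_field_line; rewrite ?ixE ?itE ?ltn_addr//.
  by rewrite -val_eqE /= ixE iyE ltn_eqF// ltn_addr.
by apply/funext => v; rewrite /Yvec mulNr scaleNr.
Qed.

Lemma derive_Xvec n (i : 'I_n) (u : V (N n) -> R) v : differentiable u v ->
  'D_(Xvec i v) u v = Xop i u v.
Proof.
move=> du; rewrite /Xop /partial !deriveE// /Xvec linearD linearZ.
by [].
Qed.

Lemma derive_Yvec n (i : 'I_n) (u : V (N n) -> R) v : differentiable u v ->
  'D_(Yvec i v) u v = Yop i u v.
Proof.
move=> du; rewrite /Yop /partial !deriveE// /Yvec linearB linearZ.
by [].
Qed.

Lemma continuous_partial k (j : 'I_k) (u : V k -> R) :
  smooth u -> continuous (partial j u).
Proof.
by move=> su v; have := su [:: evec R j] v; exact: differentiable_continuous.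
Qed.

Lemma continuous_Xop n (i : 'I_n) (u : V (N n) -> R) :
  smooth u -> continuous (Xop i u).
Proof.
move=> su v; apply: (@continuous_add R (V (N n))); first exact: continuous_partial.
apply: (@continuous_mul R (V (N n))); last exact: continuous_partial.
apply: (@continuous_mul R (V (N n))); first exact: cst_continuous.
exact: coord_continuous.
Qed.

Lemma continuous_Yop n (i : 'I_n) (u : V (N n) -> R) :
  smooth u -> continuous (Yop i u).
Proof.
move=> su v; rewrite (_ : Yop i u = fun v => partial (iy i) u v +
    (- 2 * v 0 (ix i)) * partial (it n) u v); last first.
  by apply/funext => w; rewrite /Yop mulNr mulNr.
apply: (@continuous_add R (V (N n))); first exact: continuous_partial.
apply: (@continuous_mul R (V (N n))); last exact: continuous_partial.
apply: (@continuous_mul R (V (N n))); first exact: cst_continuous.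
exact: coord_continuous.
Qed.

End Heisenberg.

(** * Summation over all the fields *)

Theorem theorem3p2 (R : realType) (n : nat) (Omega : set 'rV[R]_(N n))
  (nu : 'rV[R]_(N n) -> 'rV[R]_(N n)) (p : R) (u : 'rV[R]_(N n) -> R) :
  open Omega -> Omega !=set0 -> Omega != setT -> econvex Omega ->
  (forall xi, Omega xi -> exists xih, [/\ bdry Omega xih,
      enorm (xi - xih) = dist_bd Omega xi &
      nu xi = (enorm (xih - xi))^-1 *: (xih - xi)]) ->
  2 <= p ->
  Cc_inf Omega u ->
  ((((p - 1) / p) `^ p)%:E *
    int_on Omega (fun xi =>
      ((\sum_(i < n) (`|edot (Xvec i xi) (nu xi)| `^ p
                     + `|edot (Yvec i xi) (nu xi)| `^ p))
        / (dist_bd Omega xi `^ p) * (`|u xi| `^ p))%:E)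
  <= int_on Omega (fun xi => (hgrad_norm u xi `^ p)%:E))%E.
Proof.
move=> oO _ _ cO hnu p2 [su [K [cK KO u0]]].
have [C0 [_ HC]] := compact_bounded cK.
pose M : R := `|C0| + 1.
have M0 : 0 <= M by rewrite addr_ge0.
have KM (v : 'rV[R]_(N n)) j : M < `|v 0 j| -> ~ K v.
  move=> Mv Kv; have CM : C0 < M by rewrite (le_lt_trans (ler_norm _))// ltrDl.
  move: Mv; rewrite ltNge => /negP; apply; apply: le_trans (HC _ CM _ Kv).
  by rewrite [leRHS]mx_normrE; apply/bigmax_geP; right; exists (0, j).
have clK : closed K by apply: compact_closed => //; exact: norm_hausdorff.
have p0 : p != 0 by rewrite gt_eqF//; lra.
have du : forall v, differentiable u v := su [::].
set c := ((p - 1) / p) `^ p.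
have c0 : 0 < c by rewrite powR_gt0// divr_gt0//; lra.
pose dX i := hardy_density Omega p u (Xop i u) (@Xvec R n i).
pose dY i := hardy_density Omega p u (Yop i u) (@Yvec R n i).
have hX i := rint_hardy_density oO cO clK KO M0 KM p2 du u0 (@continuous_Xop R n i u su)
  (shear_field_Xvec R i) (fun v => derive_Xvec i (du v)).
have hY i := rint_hardy_density oO cO clK KO M0 KM p2 du u0 (@continuous_Yop R n i u su)
  (shear_field_Yvec R i) (fun v => derive_Yvec i (du v)).
have [cPhi PhiE] := cc_rint_sum (f := fun i v => dX i v + dY i v)
  (index_enum 'I_n) M0
  (fun i => let: And3 _ hx _ := hX i in let: And3 _ hy _ := hY i in ccD hx hy).
have [cPsi PsiE] := cc_rint_sum
  (f := fun i v => `|Xop i u v| `^ p + `|Yop i u v| `^ p) (index_enum 'I_n) M0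
  (fun i => let: And3 hx _ _ := hX i in let: And3 hy _ _ := hY i in ccD hx hy).
have PhiPsi : rint (fun v => \sum_i (dX i v + dY i v)) =
    rint (fun v => \sum_i (`|Xop i u v| `^ p + `|Yop i u v| `^ p)).
  rewrite PhiE PsiE; apply: eq_bigr => i _.
  have [x1 x2 x3] := hX i; have [y1 y2 y3] := hY i.
  apply: etrans (rintD M0 x2 y2) (etrans _ (esym (rintD M0 x1 y1))).
  exact: (congr2 +%R x3 y3).
have density_ge0 Du W v : 0 <= hardy_density Omega p u Du W v.
  by apply: le_trans (hardy_density_ge oO KO p2 u0 Du W v); rewrite !mulr_ge0 ?powR_ge0.
(* The [p]-th power of [normal_le_gauge] bounds the weight of one field by the gauge term of
   [hardy_density_ge]. *)
have key Du W v : Omega v -> `|edot (W v) (nu v)| `^ p *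
    ((dist_bd Omega v `^ p)^-1 * `|u v| `^ p) <=
    c^-1 * hardy_density Omega p u Du W v.
  move=> Ov; have [xih [_ dE _]] := hnu _ Ov.
  have d0 : 0 <= dist_bd Omega v by rewrite -dE sqrtr_ge0.
  rewrite ler_pdivlMl// [X in c * X]mulrA -powR_div//.
  apply: le_trans (hardy_density_ge oO KO p2 u0 Du W v).
  rewrite ler_pM2l// ler_wpM2r ?powR_ge0//.
  have wg := normal_le_gauge (W v) oO cO Ov (hnu v Ov).
  apply: ge0_ler_powR; rewrite ?nnegrE ?divr_ge0//; first lra.
  by apply: le_trans wg; rewrite divr_ge0.
have cPhi' := ccZ c^-1 cPhi.
(* The weight contains the arbitrary selection [nu], so the left side is only compared, by
   monotonicity, with a continuous majorant whose integral is then computed. *)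
apply: (@le_trans _ _ (c%:E * iint (fun v => (c^-1 * \sum_i (dX i v + dY i v))%:E))%E).
  apply: lee_wpmul2l; first by rewrite lee_fin ltW.
  apply: le_iint => v; case: asboolP => // Ov; rewrite ?lee_fin.
  - rewrite mulr_ge0 ?divr_ge0 ?powR_ge0//.
    by apply: sumr_ge0 => i _; rewrite addr_ge0 ?powR_ge0.
  - rewrite -mulrA mulr_suml mulr_sumr; apply: ler_sum => i _.
    by rewrite mulrDl mulrDr lerD// key.
  - rewrite mulr_ge0 ?invr_ge0 ?(ltW c0)// sumr_ge0// => i _.
    by rewrite addr_ge0 //; exact: density_ge0.
rewrite (iint_rint M0 cPhi') -EFinM (rintZ _ M0 cPhi) mulrA divff ?gt_eqF// mul1r PhiPsi.
rewrite -(iint_rint M0 cPsi); apply: le_iint => v.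
  rewrite lee_fin; apply: sumr_ge0 => i _; rewrite addr_ge0 ?powR_ge0//.
case: asboolP => Ov.
  by rewrite lee_fin; exact: sum_powR_le.
rewrite lee_fin big1// => i _.
(* Off [Omega] the right-hand integrand is 0 by definition of [int_on], and the derivatives of [u]
   vanish as well. *)
have nK : ~ K v by move/KO.
rewrite -derive_Xvec// -derive_Yvec//.
by rewrite !(derive_supported clK u0 _ nK) normr0 powR0// addr0.
Qed.
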